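(* Let $\mathcal{O}\subset\mathbb{R}^n$ be an obstacle that is the intersection of a finite number $K$ of primitives $\mathcal{P}_i\subset\mathbb{R}^n$, $i=1,\dots,K$, i.e. $\mathcal{O}=\bigcap_{i=1}^{K}\mathcal{P}_i$. Let $\vec p(\vec\xi)\in\mathbb{R}^n$ be the controlled system's position, depending on the vector of decision variables $\vec\xi$. Then the signed distance $\mathrm{sd}(\{\vec p(\vec\xi)\},\mathcal{O})$ is bounded from below by $$\max_{i\in\{1,\dots,K\}}\ \mathrm{sd}(\{\vec p(\vec\xi)\},\mathcal{P}_i)\ \le\ \mathrm{sd}(\{\vec p(\vec\xi)\},\mathcal{O}).$$
   Context: The vector $\vec\xi$ is a vector of real decision variables of a nonlinear program; $\vec p(\vec\xi)$ is simply a point of $\mathbb{R}^n$ for each $\vec\xi$. ''Primitives'' are subsets of $\mathbb{R}^n$ (e.g. half-spaces or balls). For sets $\mathcal{V},\mathcal{O}\subset\mathbb{R}^n$ and $\vec p\in\mathbb{R}^n$, write $\mathcal{V}+\vec p=\{\vec v+\vec p : \vec v\in\mathcal{V}\}$, and let $\lVert\cdot\rVert$ be the Euclidean norm. Define the distance $$\mathrm{dist}(\mathcal{V},\mathcal{O})=\inf_{\vec p\in\mathbb{R}^n}\{\lVert\vec p\rVert : (\mathcal{V}+\vec p)\cap\mathcal{O}\neq\emptyset\},$$ the penetration $$\mathrm{pen}(\mathcal{V},\mathcal{O})=\inf_{\vec p\in\mathbb{R}^n}\{\lVert\vec p\rVert : (\mathcal{V}+\vec p)\cap\mathcal{O}=\emptyset\},$$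 and the signed distance $$\mathrm{sd}(\mathcal{V},\mathcal{O})=\mathrm{dist}(\mathcal{V},\mathcal{O})-\mathrm{pen}(\mathcal{V},\mathcal{O}).$$ The infimum of the empty set is $+\infty$, so these quantities are extended real numbers. *)

(* Defs.v *)
From mathcomp Require Import all_boot all_order all_algebra.
From mathcomp Require Import all_classical all_reals all_analysis.

Set Implicit Arguments.
Unset Strict Implicit.
Unset Printing Implicit Defensive.

Import Order.TTheory GRing.Theory Num.Theory.

Local Open Scope classical_set_scope.
Local Open Scope ring_scope.

(* The norm `|x| that MathComp-Analysis puts on 'rV[R]_n is the sup norm, so
   the Euclidean norm is defined separately. *)
Definition enorm (R : realType) (n : nat) (x : 'rV[R]_n) : R :=
  Num.sqrt (\sum_(j < n) x ord0 j ^+ 2).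

Definition translate (R : realType) (n : nat) (V : set 'rV[R]_n)
    (p : 'rV[R]_n) : set 'rV[R]_n :=
  [set v + p | v in V].

Definition dist (R : realType) (n : nat) (V O : set 'rV[R]_n) : \bar R :=
  ereal_inf [set (enorm p)%:E | p in [set p | translate V p `&` O !=set0]].

Definition pen (R : realType) (n : nat) (V O : set 'rV[R]_n) : \bar R :=
  ereal_inf [set (enorm p)%:E | p in [set p | translate V p `&` O = set0]].

(* The difference is never of the form +oo - +oo: dist V O = +oo only when V or
   O is empty, and then pen V O = 0 (take p = 0). *)
Definition sd (R : realType) (n : nat) (V O : set 'rV[R]_n) : \bar R :=
  (dist V O - pen V O)%E.

(* Main.v *)
Require Import Defs.
From mathcomp Require Import all_boot all_order all_algebra.
From mathcomp Require Import all_classical all_reals all_analysis.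

Local Open Scope classical_set_scope.
Local Open Scope ring_scope.

(** The signed distance is antitone in the obstacle.  When the obstacle grows,
    every translation that produces contact still does, so the infimum [dist]
    can only decrease ([dist_antitone]); and every translation that removes
    contact with the larger obstacle also removes it from the smaller one, so
    the infimum [pen] can only increase ([pen_monotone]).  An intersection of
    primitives is contained in each of them, hence its signed distance dominates
    each of theirs ([sd_antitone]), and therefore their maximum. *)

Lemma dist_antitone (R : realType) (n : nat) (V A B : set 'rV[R]_n) :
  A `<=` B -> (dist V B <= dist V A)%E.
Proof.
move=> AB; apply: ereal_inf_le_tmp; apply: image_subset => q /= [v [Vv Av]].
by exists v; split=> //; apply: AB.
Qed.

Lemma pen_monotone (R : realType) (n : nat) (V A B : set 'rV[R]_n) :
  A `<=` B -> (pen V A <= pen V B)%E.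
Proof.
move=> AB; apply: ereal_inf_le_tmp; apply: image_subset => q /=.
exact: subsetI_eq0.
Qed.

(** The two inequalities can be subtracted even at infinite values: addition on
    the extended reals is monotone everywhere, with [+oo - oo = -oo]. *)
Lemma sd_antitone (R : realType) (n : nat) (V A B : set 'rV[R]_n) :
  A `<=` B -> (sd V B <= sd V A)%E.
Proof.
by move=> AB; apply: leeB; [apply: dist_antitone | apply: pen_monotone].
Qed.

Theorem proposition1 (R : realType) (n m K : nat) (K_gt0 : (0 < K)%N)
    (P : 'I_K -> set 'rV[R]_n) (O : set 'rV[R]_n)
    (O_eq : O = \bigcap_(i in [set: 'I_K]) P i)
    (p : 'rV[R]_m -> 'rV[R]_n) (xi : 'rV[R]_m) :
  (\big[maxe/-oo]_(i < K) sd [set p xi] (P i) <= sd [set p xi] O)%E.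
Proof.
apply: Order.POrderTheory.bigmax_le => [|i _]; first exact: leNye.
by apply: sd_antitone; rewrite O_eq; apply: bigcap_inf.
Qed.
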